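(* Let $Z=(Z_{\mathbf{x},t})_{(\mathbf{x},t)\in D\times\mathcal{T}}$ be a measurable real-valued random field that is exponentially integrable alongside $\mathcal{T}$. The following are equivalent: (1) there exists a measurable Gaussian process $\tilde Z=(\tilde Z_{\mathbf{x},t})_{(\mathbf{x},t)\in D\times\mathcal{T}}$ that is exponentially integrable alongside $\mathcal{T}$ and such that $\Psi[Z]=\Psi[\tilde Z]$; (2) $\left(Z_{\mathbf{x},t}-Z_{\mathbf{x},t'}\right)_{(\mathbf{x},t,t')\in D\times\mathcal{T}^2}$ is a Gaussian process.
   Context: All random fields are defined on the ambient probability space $(\Omega,\mathcal{F},P)$. $D\subset\mathbb{R}^{d_D}$ ($d_D\ge1$) is compact and convex; $\mathcal{T}\subset\mathbb{R}$ is compact and convex with $\lambda(\mathcal{T})>0$, where $\lambda$ is Lebesgue measure. A measurable random field $Z$ on $D\times\mathcal{T}$ is exponentially integrable alongside $\mathcal{T}$ if $\int_{\mathcal{T}}e^{Z_{\mathbf{x},u}(\omega)}\,d\lambda(u)<\infty$ for every $(\mathbf{x},\omega)\in D\times\Omega$. For such $Z$, $$\Psi[Z](\mathbf{x},t)=\frac{e^{Z_{\mathbf{x},t}}}{\int_{\mathcal{T}}e^{Z_{\mathbf{x},u}}\,d\lambda(u)},\qquad (\mathbf{x},t)\in D\times\mathcal{T},$$ and $\Psi[Z]=\Psi[\tilde Z]$ means equality for all $(\mathbf{x},t)\in D\times\mathcal{T}$ and all $\omega\in\Omega$. A Gaussian process is a random field (not necessarily centred) all of whose finite-dimensional distributions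 are (possibly degenerate) multivariate normal. *)

(* Defs.v *)
From HB Require Import structures.
From mathcomp Require Import all_boot all_order all_algebra.
From mathcomp Require Import all_classical all_reals all_analysis.

Set Implicit Arguments.
Unset Strict Implicit.
Unset Printing Implicit Defensive.

Import Order.TTheory GRing.Theory Num.Theory.
Import numFieldNormedType.Exports.

Local Open Scope classical_set_scope.
Local Open Scope ring_scope.

(* R^d with its Borel sigma-algebra: the library has no measurable structure on
   row vectors. *)
Definition borel_rV (R : realType) (d : nat) :=
  g_sigma_algebraType (@open 'rV[R]_d).

(* The degenerate case is stated apart because the library's [normal_prob m 0]
   is the uniform law on [0, 1], not the Dirac mass at m. *)
Definition is_normal (R : realType) (mu : set (measurableTypeR R) -> \bar R) :
    Prop :=
  (exists m : R, forall A : set (measurableTypeR R),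
     measurable A -> mu A = dirac (m : measurableTypeR R) A) \/
  (exists m s : R, 0 < s /\ forall A : set (measurableTypeR R),
     measurable A -> mu A = normal_prob m s A).

(* A law on R^n, possibly degenerate, is multivariate normal when each of its
   images under a linear form is a univariate normal law, point masses
   included. *)
Definition is_multivariate_normal (R : realType) (n : nat)
    (mu : set (n.-tuple (measurableTypeR R)) -> \bar R) : Prop :=
  forall a : 'I_n -> R,
    is_normal (pushforward mu
      (fun x : n.-tuple (measurableTypeR R) =>
         (\sum_(i < n) a i * tnth x i : measurableTypeR R))).

Definition fin_dim_law (R : realType) (dO : measure_display)
    (Omega : measurableType dO) (P : probability Omega R) (I : Type)
    (X : I -> Omega -> R) (n : nat) (p : 'I_n -> I) :
    set (n.-tuple (measurableTypeR R)) -> \bar R :=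
  pushforward P
    (fun w : Omega => [tuple (X (p k) w : measurableTypeR R) | k < n]).

(* Processes indexed by a subset A of a type I are total functions on I whose
   values outside A are irrelevant. *)
Definition gaussian_process (R : realType) (dO : measure_display)
    (Omega : measurableType dO) (P : probability Omega R) (I : Type)
    (A : set I) (X : I -> Omega -> R) : Prop :=
  (forall i, A i ->
     measurable_fun [set: Omega] (X i : Omega -> measurableTypeR R)) /\
  (forall (n : nat) (p : 'I_n -> I), (forall k, A (p k)) ->
     is_multivariate_normal (fin_dim_law P X p)).

Section random_fields.
Context (R : realType) (d : nat) (dO : measure_display)
  (Omega : measurableType dO).
Implicit Types (D : set 'rV[R]_d) (T : set R) (Z : 'rV[R]_d -> R -> Omega -> R).

(* Measurability is joint in (x, t, omega). *)
Definition measurable_field D T Z : Prop :=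
  measurable_fun
    ((D `*` T `*` [set: Omega]) :
       set (borel_rV R d * measurableTypeR R * Omega)%type)
    (fun p => (Z p.1.1 p.1.2 p.2 : measurableTypeR R)).

Definition exp_integrable D T Z : Prop :=
  forall x w, D x ->
    (\int[@lebesgue_measure R]_(u in T) (expR (Z x u w))%:E < +oo)%E.

Definition Psi T Z (x : 'rV[R]_d) (t : R) (w : Omega) : R :=
  expR (Z x t w) / \int[@lebesgue_measure R]_(u in T) expR (Z x u w).

End random_fields.

(* Main.v *)
(* Psi[Z] and the increments of Z in t determine each other: the logarithm of
   Psi[Z](x, t) is Z_(x, t) minus a finite quantity independent of t, and Psi is
   unchanged when such a quantity is subtracted from Z. Increments of a Gaussian
   process are jointly Gaussian; conversely, if the increments of Z are, then
   Z_(x, t) - Z_(x, t0) for a fixed t0 in T is the required Gaussian process. *)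
Require Import Defs.
From HB Require Import structures.
From mathcomp Require Import all_boot all_order all_algebra.
From mathcomp Require Import all_classical all_reals all_analysis.
From mathcomp Require Import measurable_realfun lra.

Set Implicit Arguments.
Unset Strict Implicit.
Unset Printing Implicit Defensive.

Import Order.TTheory GRing.Theory Num.Theory.
Import numFieldNormedType.Exports.

Local Open Scope classical_set_scope.
Local Open Scope ring_scope.

Section gaussian_processes.
Context (R : realType) (dO : measure_display) (Omega : measurableType dO).
Variable P : probability Omega R.

(** Pushing [P] forward to tuples and then along a linear form is pushing it forward once, along the
    composite. Joint normality can thus be checked on linear combinations of the random
    variables. *)
Lemma is_multivariate_normal_fin_dim_lawP (I : Type) (X : I -> Omega -> R)
    (n : nat) (p : 'I_n -> I) :
  is_multivariate_normal (fin_dim_law P X p) <->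
  forall a : 'I_n -> R,
    is_normal (pushforward P
      (fun w => (\sum_(i < n) a i * X (p i) w : measurableTypeR R))).
Proof.
suff E (a : 'I_n -> R) : pushforward (fin_dim_law P X p)
      (fun x : n.-tuple (measurableTypeR R) =>
         (\sum_(i < n) a i * tnth x i : measurableTypeR R)) =
    pushforward P
      (fun w => (\sum_(i < n) a i * X (p i) w : measurableTypeR R)).
  by split=> H a; move: (H a); rewrite E.
apply/funext => A; congr (P (_ @^-1` A)); apply/funext => w /=.
by apply: eq_bigr => i _; rewrite tnth_mktuple.
Qed.

(** On [B], linear combinations of [Y] along [p] are those of [X] along [q \o p]. *)
Lemma gaussian_process_reindex (I J : Type) (A : set I) (B : set J)
    (X : I -> Omega -> R) (Y : J -> Omega -> R) (q : J -> I) :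
  (forall j, B j -> A (q j)) -> (forall j, B j -> Y j = X (q j)) ->
  gaussian_process P A X -> gaussian_process P B Y.
Proof.
move=> BA YX [mX gX]; split=> [j Bj|n p Bp].
  by rewrite YX//; exact/mX/BA.
apply/is_multivariate_normal_fin_dim_lawP => a.
have /is_multivariate_normal_fin_dim_lawP/(_ a) :=
  gX n (q \o p) (fun k => BA _ (Bp k)).
congr (is_normal (pushforward _ _)); apply/funext => w.
by apply: eq_bigr => i _; rewrite YX.
Qed.

(** A linear combination of [n] differences of values of [X] is a linear combination of [n + n]
    values, with coefficients [a] on the first half and [- a] on the second. *)
Lemma gaussian_process_sub (I J : Type) (A : set I) (B : set J)
    (X : I -> Omega -> R) (Y : J -> Omega -> R) (q r : J -> I) :
  (forall j, B j -> A (q j)) -> (forall j, B j -> A (r j)) ->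
  (forall j, B j -> Y j = (fun w => X (q j) w - X (r j) w)) ->
  gaussian_process P A X -> gaussian_process P B Y.
Proof.
move=> BAq BAr YX [mX gX]; split=> [j Bj|n p Bp].
  by rewrite YX//; apply: measurable_funB; [exact/mX/BAq|exact/mX/BAr].
apply/is_multivariate_normal_fin_dim_lawP => a.
(* The same index may occur several times in [p']; this is harmless, since [gaussian_process]
   quantifies over arbitrary finite families of indices. *)
pose p' (k : 'I_(n + n)) :=
  match fintype.split k with inl i => q (p i) | inr i => r (p i) end.
pose a' (k : 'I_(n + n)) :=
  match fintype.split k with inl i => a i | inr i => - a i end.
have Ap' k : A (p' k).
  by rewrite /p'; case: fintype.split => i; [exact/BAq/Bp|exact/BAr/Bp].
have /is_multivariate_normal_fin_dim_lawP/(_ a') := gX _ p' Ap'.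
congr (is_normal (pushforward _ _)); apply/funext => w.
rewrite big_split_ord /= -big_split /=; apply: eq_bigr => i _.
rewrite /a' /p' (unsplitK (inl i : 'I_n + 'I_n)%type).
rewrite (unsplitK (inr i : 'I_n + 'I_n)%type) YX//.
by rewrite mulrBr mulNr.
Qed.

End gaussian_processes.

Section random_fields.
Context (R : realType) (d : nat) (dO : measure_display)
  (Omega : measurableType dO).
Variables (D : set 'rV[R]_d) (T : set R).
Hypotheses (D_compact : compact D) (T_compact : compact T).
Implicit Types Z : 'rV[R]_d -> R -> Omega -> R.

Local Notation index_set := ((D `*` T `*` [set: Omega]) :
  set (borel_rV R d * measurableTypeR R * Omega)%type).

Lemma compact_measurable_rV : measurable (D : set (borel_rV R d)).
Proof.
rewrite -(setCK D); apply: measurableC; apply: sub_sigma_algebra.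
by apply: closed_openC; exact: compact_closed.
Qed.

Lemma measurable_index_set : measurable index_set.
Proof.
apply: measurableX => //; apply: measurableX.
  exact: compact_measurable_rV.
exact: compact_measurable.
Qed.

Lemma measurable_field_section Z x w : measurable_field D T Z -> D x ->
  measurable_fun (T : set (measurableTypeR R))
    (fun u => (Z x u w : measurableTypeR R)).
Proof.
move=> mZ Dx.
pose g (u : measurableTypeR R) := ((x : borel_rV R d, u), w).
apply: (@measurable_comp _ _ _ _ _ _ index_set
  (fun p => (Z p.1.1 p.1.2 p.2 : measurableTypeR R)) T g).
- exact: measurable_index_set.
- by move=> _ [u Tu <-].
- exact: mZ.
- by apply: measurable_funTS; apply: measurable_fun_pair.
Qed.

(** The subtracted term is [Z] composed with the measurable map (x, t, w) |-> (x, t0, w), which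
    sends the index set into itself because [t0] lies in [T]. *)
Lemma measurable_field_anchored Z t0 : T t0 -> measurable_field D T Z ->
  measurable_field D T (fun x t w => Z x t w - Z x t0 w).
Proof.
move=> Tt0 mZ; apply: measurable_funB; first exact: mZ.
pose g (p : (borel_rV R d * measurableTypeR R * Omega)%type) :=
  ((p.1.1, t0 : measurableTypeR R), p.2).
apply: (@measurable_comp _ _ _ _ _ _ index_set
  (fun p => (Z p.1.1 p.1.2 p.2 : measurableTypeR R)) index_set g).
- exact: measurable_index_set.
- by move=> _ [[[x t] w] [[Dx Tt] _] <-].
- exact: mZ.
- apply: measurable_funTS; apply: measurable_fun_pair => //.
  by apply: measurable_fun_pair => //; exact: measurableT_comp.
Qed.

(** Stated in the extended reals, so that it yields both the finiteness of the shifted integral and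
    its value. *)
Lemma integral_expR_subr Z x w (c : R) : measurable_field D T Z -> D x ->
  (\int[@lebesgue_measure R]_(u in T) (expR (Z x u w - c))%:E =
   (expR (- c))%:E * \int[@lebesgue_measure R]_(u in T) (expR (Z x u w))%:E)%E.
Proof.
move=> mZ Dx.
rewrite -ge0_integralZl_EFin ?expR_ge0//.
- by apply: eq_integral => u _; rewrite expRD mulrC EFinM.
- exact: compact_measurable.
- apply/measurable_EFinP; apply: measurableT_comp => //.
  exact: measurable_field_section.
Qed.

(** A nonnegative function with zero integral vanishes almost everywhere; the exponential vanishes
    nowhere, so [T] would be a null set. *)
Lemma Rintegral_expR_gt0 Z x w : (0 < @lebesgue_measure R T)%E ->
  measurable_field D T Z -> exp_integrable D T Z -> D x ->
  0 < \int[@lebesgue_measure R]_(u in T) expR (Z x u w).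
Proof.
(* As [fine] sends an infinite integral to 0, finiteness is required here as well. *)
move=> T_pos mZ iZ Dx; apply: fine_gt0; rewrite iZ// andbT.
rewrite lt0e integral_ge0 ?andbT; last first.
  by move=> u _; rewrite lee_fin expR_ge0.
apply/negP => /eqP I0.
have mT : measurable (T : set (measurableTypeR R)) by exact: compact_measurable.
have mf : measurable_fun (T : set (measurableTypeR R))
    (fun u => (expR (Z x u w))%:E).
  apply/measurable_EFinP; apply: measurableT_comp => //.
  exact: measurable_field_section.
have [N [mN N0 TN]] : ae_eq (@lebesgue_measure R) T
    (fun u => (expR (Z x u w))%:E) (cst 0%E).
  apply/ae_eq_integral_abs => //; rewrite -[RHS]I0.
  by apply: eq_integral => u _; rewrite gee0_abs// lee_fin expR_ge0.
have : @lebesgue_measure R T = 0%E.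
  apply: (subset_measure0 mT mN _ N0) => u Tu; apply: TN => /(_ Tu)/=.
  by move=> [e0]; have := expR_gt0 (Z x u w); rewrite e0 ltxx.
by apply/eqP; rewrite gt_eqF.
Qed.

(** The factor [expR (- c x w)] leaves the integral and cancels against the one in the numerator. *)
Lemma PsiB Z (c : 'rV[R]_d -> Omega -> R) x t w :
  measurable_field D T Z -> exp_integrable D T Z -> D x ->
  Psi T (fun x t w => Z x t w - c x w) x t w = Psi T Z x t w.
Proof.
move=> mZ iZ Dx; rewrite /Psi /Rintegral integral_expR_subr//.
rewrite fineM//; last first.
  by rewrite ge0_fin_numE ?iZ ?integral_ge0.
by rewrite expRD [_ * expR (- _)]mulrC -mulf_div divff ?mul1r// gt_eqF// expR_gt0.
Qed.

Lemma Psi_eq_sub Z Z' x t t' w : (0 < @lebesgue_measure R T)%E ->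
  measurable_field D T Z -> exp_integrable D T Z ->
  measurable_field D T Z' -> exp_integrable D T Z' -> D x ->
  Psi T Z x t w = Psi T Z' x t w -> Psi T Z x t' w = Psi T Z' x t' w ->
  Z x t w - Z x t' w = Z' x t w - Z' x t' w.
Proof.
move=> T_pos mZ iZ mZ' iZ' Dx.
have I_gt0 := Rintegral_expR_gt0 w T_pos mZ iZ Dx.
have I'_gt0 := Rintegral_expR_gt0 w T_pos mZ' iZ' Dx.
rewrite /Psi => Et Et'.
suff lnPsi (y I : R) : 0 < I -> ln (expR y / I) = y - ln I.
  (* For each field, the same normalising integral occurs at [t] and at [t'], so its logarithm drops
     out when the two equations are subtracted. *)
  have := congr1 (@ln R) Et; have := congr1 (@ln R) Et'.
  by rewrite !lnPsi// => ? ?; lra.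
by move=> I0; rewrite ln_div ?posrE ?expR_gt0// expRK.
Qed.

End random_fields.

Theorem proposition2p2 (R : realType) (dO : measure_display)
    (Omega : measurableType dO) (P : probability Omega R)
    (d : nat) (d_gt0 : (0 < d)%N)
    (D : set 'rV[R]_d) (D_compact : compact D)
    (D_convex : convex_set (D : set (convex_lmodType 'rV[R]_d)))
    (T : set R) (T_compact : compact T)
    (T_convex : convex_set (T : set (convex_lmodType R^o)))
    (T_pos : (0 < @lebesgue_measure R T)%E)
    (Z : 'rV[R]_d -> R -> Omega -> R)
    (Z_meas : measurable_field D T Z)
    (Z_int : exp_integrable D T Z) :
  (exists Z' : 'rV[R]_d -> R -> Omega -> R,
     [/\ measurable_field D T Z',
         gaussian_process P (D `*` T)
           (fun p : 'rV[R]_d * R => Z' p.1 p.2),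
         exp_integrable D T Z' &
         forall x t w, D x -> T t -> Psi T Z x t w = Psi T Z' x t w])
  <->
  gaussian_process P (D `*` (T `*` T))
    (fun (p : 'rV[R]_d * (R * R)) w => Z p.1 p.2.1 w - Z p.1 p.2.2 w).
Proof.
split=> [[Z' [mZ' gZ' iZ' PsiE]]|gZ].
  apply: (gaussian_process_sub (q := fun p => (p.1, p.2.1))
    (r := fun p => (p.1, p.2.2)) _ _ _ gZ').
  - by move=> [x [t t']] [? []].
  - by move=> [x [t t']] [? []].
  - move=> [x [t t']] [/= Dx [Tt Tt']]; apply/funext => w.
    exact: (Psi_eq_sub D_compact T_compact T_pos Z_meas Z_int mZ' iZ' Dx
      (PsiE _ _ _ Dx Tt) (PsiE _ _ _ Dx Tt')).
have [t0 Tt0] : T !=set0.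
  by apply/set0P/eqP => T0; move: T_pos; rewrite T0 measure0 ltxx.
exists (fun x t w => Z x t w - Z x t0 w); split.
- exact: measurable_field_anchored.
- apply: (gaussian_process_reindex (q := fun p => (p.1, (p.2, t0))) _ _ gZ) => //.
  by move=> [x t] [].
(* The shift multiplies a finite integral by the real number [expR (- Z x t0 w)]. *)
- move=> x w Dx; rewrite (integral_expR_subr D_compact T_compact)//.
  by rewrite lte_mul_pinfty ?lee_fin ?expR_ge0//; exact: Z_int.
- by move=> x t w Dx Tt; rewrite (PsiB D_compact T_compact (fun x => Z x t0)).
Qed.
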